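(* Let $\phi:\mathbb{R}^d\to\mathbb{R}$ be a continuous function, and let $G\subset\mathbb{S}^{d-1}$ satisfy: (C1) the open half-spaces $H_u$ with $u\in G$ cover $\mathbb{S}^{d-1}$, and (C2) the reflections $\{R_u\mid u\in G\}$ generate a dense subgroup of $O(d)$. Then $S_u\phi=\phi$ for all $u\in G$ if and only if $\phi$ is radial.
   Context: $\mathbb{S}^{d-1}$ is the set of unit vectors in $\mathbb{R}^d$; $O(d)$ is the group of orthogonal linear transformations of $\mathbb{R}^d$. For $u\in\mathbb{S}^{d-1}$: $R_u x=x-2(x\cdot u)u$ is the reflection about $u^\perp$; $H_u=\{x\in\mathbb{R}^d\mid x\cdot u>0\}$. The two-point symmetrization of a real-valued function $\phi$ is $S_u\phi(x)=\max\{\phi(R_ux),\phi(x)\}$ if $x\in H_u$, and $S_u\phi(x)=\min\{\phi(R_ux),\phi(x)\}$ otherwise. A function on $\mathbb{R}^d$ is radial if it is constant on each centered sphere $\{|x|=r\}$. *)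

(* Defs.v *)
From HB Require Import structures.
From mathcomp Require Import all_boot all_order all_algebra.
From mathcomp Require Import all_classical all_reals all_analysis.

Set Implicit Arguments.
Unset Strict Implicit.
Unset Printing Implicit Defensive.

Import Order.TTheory GRing.Theory Num.Theory.
Import numFieldNormedType.Exports.

Local Open Scope classical_set_scope.
Local Open Scope ring_scope.

(* The library norm on 'rV[R]_d is the max norm, hence the explicit Euclidean
   norm; both induce the same (library) topology. *)
Definition dotr (R : realType) (d : nat) (x y : 'rV[R]_d) : R :=
  \sum_i x ord0 i * y ord0 i.

Definition enorm (R : realType) (d : nat) (x : 'rV[R]_d) : R :=
  Num.sqrt (dotr x x).

Definition unit_sphere (R : realType) (d : nat) : set 'rV[R]_d :=
  [set x | enorm x = 1].
Arguments unit_sphere R d : clear implicits.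

Definition half_space (R : realType) (d : nat) (u : 'rV[R]_d) : set 'rV[R]_d :=
  [set x | 0 < dotr x u].

Definition reflection (R : realType) (d : nat) (u x : 'rV[R]_d) : 'rV[R]_d :=
  x - (2 * dotr x u) *: u.

Definition two_point_symm (R : realType) (d : nat) (u : 'rV[R]_d)
    (phi : 'rV[R]_d -> R) : 'rV[R]_d -> R :=
  fun x => if x \in half_space u then Num.max (phi (reflection u x)) (phi x)
           else Num.min (phi (reflection u x)) (phi x).

Definition radial (R : realType) (d : nat) (phi : 'rV[R]_d -> R) : Prop :=
  forall x y : 'rV[R]_d, enorm x = enorm y -> phi x = phi y.

(* Linear maps of R^d are identified with matrices acting on row vectors on the
   right, x |-> x *m A. *)
Definition orthogonal_group (R : realType) (d : nat) : set 'M[R]_d :=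
  [set A | A *m A^T = 1%:M].
Arguments orthogonal_group R d : clear implicits.

Fact reflection_is_linear (R : realType) (d : nat) (u : 'rV[R]_d) :
  linear (reflection u).
Proof.
move=> a x y; rewrite /reflection scalerBr scalerA addrACA -opprD -scalerDl.
congr (_ - _ *: _); rewrite mulrCA -mulrDr; congr (_ * _).
rewrite /dotr mulr_sumr -big_split /=; apply: eq_bigr => i _.
by rewrite !mxE mulrDl mulrA.
Qed.

HB.instance Definition _ (R : realType) (d : nat) (u : 'rV[R]_d) :=
  GRing.isLinear.Build R 'rV[R]_d 'rV[R]_d _ (reflection u)
    (reflection_is_linear u).

Definition reflection_mx (R : realType) (d : nat) (u : 'rV[R]_d) : 'M[R]_d :=
  lin1_mx (reflection u).

Definition is_orthogonal_subgroup (R : realType) (d : nat)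
    (K : set 'M[R]_d) : Prop :=
  [/\ K `<=` orthogonal_group R d,
      K 1%:M,
      (forall A B, K A -> K B -> K (A *m B)) &
      (forall A, K A -> K (invmx A))].

(* Meaningful for X `<=` orthogonal_group R d. *)
Definition generated_subgroup (R : realType) (d : nat) (X : set 'M[R]_d) :
    set 'M[R]_d :=
  smallest (@is_orthogonal_subgroup R d) X.

Definition dense_in_orthogonal_group (R : realType) (d : nat)
    (K : set 'M[R]_d) : Prop :=
  K `<=` orthogonal_group R d /\ orthogonal_group R d `<=` closure K.

(* Main.v *)
Require Import Defs.
From HB Require Import structures.
From mathcomp Require Import all_boot all_order all_algebra.
From mathcomp Require Import all_classical all_reals all_analysis.
From mathcomp Require Import ring lra.

(** If phi is polarized, (phi(x) - phi(R_u x)) (x.u) >= 0 for all x and u in G.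
    Averaging phi(x) x over a sphere gives a vector c with c.u >= 0 for all u in
    G, with equality only if phi is R_u-invariant on the sphere. By (C1), c = 0:
    some u in G has (-c).u > 0 otherwise. Hence phi is invariant under all R_u,
    then under the dense group they generate, then by continuity under O(d).
    Instead of the surface measure we average over finite samples of the group
    generated by the R_u, in the manner of von Neumann's mean of an almost
    periodic function: the averages can be made invariant up to any error. *)

Set Implicit Arguments.
Unset Strict Implicit.
Unset Printing Implicit Defensive.

Import Order.TTheory GRing.Theory Num.Theory.
Import numFieldNormedType.Exports.

Local Open Scope classical_set_scope.
Local Open Scope ring_scope.

(** * Means of almost periodic functions on a subgroup of O(d) *)

Section AlmostPeriodic.
Variables (R : realType) (d : nat) (K : set 'M[R]_d).
Hypothesis groupK : is_orthogonal_subgroup K.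
Implicit Types (F : 'M[R]_d -> R) (w s : seq 'M[R]_d).

(** Maak's form of von Neumann's almost periodicity, stated without a topology on [K]. The bound is
    uniform in both [x] and [y], so it can absorb translations on either side. *)
Definition almost_periodic F : Prop := forall e : R, 0 < e ->
  exists2 s : seq 'M[R]_d, {in s, forall b, K b} &
    forall a, K a -> exists2 b, b \in s &
      forall x y, K x -> K y -> `|F (x *m a *m y) - F (x *m b *m y)| <= e.

Definition sample w : Prop := w != [::] /\ {in w, forall g, K g}.

Definition left_average w F (x : 'M[R]_d) : R :=
  (\sum_(g <- w) F (g *m x)) / (size w)%:R.

Lemma subgroup1 : K 1%:M. Proof. by case: groupK. Qed.

Lemma subgroupM a b : K a -> K b -> K (a *m b).
Proof. by case: groupK => _ _ + _; apply. Qed.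

Lemma subgroupV a : K a -> K (invmx a).
Proof. by case: groupK => _ _ _; apply. Qed.

Lemma subgroup_unit a : K a -> a \in unitmx.
Proof. by case: groupK => + _ _ _ => /[apply]/mulmx1_unit[]. Qed.

Lemma sample_size w : sample w -> 0 < (size w)%:R :> R.
Proof. by case; case: w => // a w _ _; rewrite ltr0n. Qed.

Lemma ler_sum_seq w (f h : 'M[R]_d -> R) :
  {in w, forall g, f g <= h g} -> \sum_(g <- w) f g <= \sum_(g <- w) h g.
Proof.
move=> le_fh; rewrite big_seq [leRHS]big_seq.
by apply: ler_sum => g gw; apply: le_fh.
Qed.

Lemma sum_const_seq w (c : R) : \sum_(g <- w) c = (size w)%:R * c.
Proof. by rewrite big_const_seq count_predT iter_addr_0 mulr_natl. Qed.

Lemma left_average_le w F t x : sample w -> K x ->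
  (forall y, K y -> F y <= t) -> left_average w F x <= t.
Proof.
move=> sw Kx le_t; rewrite ler_pdivrMr ?sample_size // mulrC -sum_const_seq.
by apply: ler_sum_seq => g gw; apply/le_t/subgroupM => //; apply: sw.2.
Qed.

Lemma left_average_ge w F t x : sample w -> K x ->
  (forall y, K y -> t <= F y) -> t <= left_average w F x.
Proof.
move=> sw Kx ge_t; rewrite ler_pdivlMr ?sample_size // mulrC -sum_const_seq.
by apply: ler_sum_seq => g gw; apply/ge_t/subgroupM => //; apply: sw.2.
Qed.

Lemma left_averageB w F F' x y :
  left_average w F x - left_average w F' y =
  (\sum_(g <- w) (F (g *m x) - F' (g *m y))) / (size w)%:R.
Proof. by rewrite -mulrBl -sumrB. Qed.

Lemma left_average_dist w F x y e : sample w ->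
  {in w, forall g, `|F (g *m x) - F (g *m y)| <= e} ->
  `|left_average w F x - left_average w F y| <= e.
Proof.
move=> sw le_e; rewrite left_averageB normrM normfV normr_nat.
rewrite ler_pdivrMr ?sample_size // mulrC -sum_const_seq.
by apply: le_trans (ler_norm_sum _ _ _) _; apply: ler_sum_seq.
Qed.

(** The net of [F] serves again: each sample point [g] is absorbed into the left factor [x]. *)
Lemma almost_periodic_average w F :
  sample w -> almost_periodic F -> almost_periodic (left_average w F).
Proof.
move=> sw apF e /apF[s sK sP]; exists s => // a /sP[b bs abP].
exists b => // x y Kx Ky; apply: left_average_dist => // g gw.
by rewrite !mulmxA; apply: abP => //; apply: subgroupM => //; apply: sw.2.
Qed.

Lemma almost_periodic_lbound F :
  almost_periodic F -> exists B, forall a, K a -> B <= F a.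
Proof.
move=> /(_ 1 ltr01)[s sK sP]; exists (- (\sum_(b <- s) `|F b|) - 1) => a /sP[b bs].
move=> /(_ _ _ subgroup1 subgroup1); rewrite !mul1mx !mulmx1 (big_rem b) //=.
have : 0 <= \sum_(y <- rem b s) `|F y| by apply: sumr_ge0.
rewrite ler_norml; have := ler_norm (- F b); rewrite normrN; lra.
Qed.

Definition sample_mul w w' := [seq p.1 *m p.2 | p <- [seq (g, h) | g <- w, h <- w']].

Lemma sample_mulP w w' : sample w -> sample w' -> sample (sample_mul w w').
Proof.
move=> sw sw'; split.
  rewrite -size_eq0 size_map size_allpairs muln_eq0 !size_eq0 negb_or.
  by rewrite sw.1 sw'.1.
move=> _ /mapP[_ /allpairsP[[g h] [/= gw hw ->]] ->].
by apply: subgroupM; [apply: sw.2 | apply: sw'.2].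
Qed.

(** This packs successive improvements of an average into a single sample. *)
Lemma left_average_mul w w' F x :
  left_average (sample_mul w w') F x = left_average w' (left_average w F) x.
Proof.
rewrite /left_average big_map size_map size_allpairs big_allpairs /=.
rewrite -mulr_suml exchange_big /= natrM invfM mulrA; congr (_ / _ / _).
by apply: eq_bigr => h _; apply: eq_bigr => g _; rewrite mulmxA.
Qed.

(* If an average h of F falls to t - 2e at y, average h further over the left
   translations by y b^-1, b in an e-net: at each x, the term with b near x is
   close to h y, and the other terms are at most t. *)
Lemma left_average_decrease F e : 0 < e -> almost_periodic F ->
  exists2 c, 0 < c & forall w t, sample w ->
    (forall x, K x -> left_average w F x <= t) ->
    (exists2 y, K y & left_average w F y <= t - 2 * e) ->
    exists2 w', sample w' & forall x, K x -> left_average w' F x <= t - c.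
Proof.
move=> e0 apF; have [s sK sP] := apF _ e0.
have s_neq0 : s != [::] by have [b] := sP _ subgroup1; case: (s).
have s0 : 0 < (size s)%:R :> R by apply: (@sample_size s).
(* One of the [size s] terms falls short of [t] by [e], hence this gain in the mean. It does not
   depend on [w]. *)
exists (e / (size s)%:R) => [|w t sw le_t [y Ky le_y]]; first exact: divr_gt0.
set s' := [seq y *m invmx b | b <- s].
have ss' : sample s'.
  split; first by rewrite -size_eq0 size_map size_eq0.
  by move=> _ /mapP[b /sK Kb ->]; apply/subgroupM/subgroupV.
exists (sample_mul w s'); first exact: sample_mulP.
move=> x Kx; rewrite left_average_mul.
have [b bs bP] := sP _ Kx.
rewrite /left_average ler_pdivrMr ?sample_size // size_map big_map.
rewrite -!/(left_average _ _ _) mulrBl divfK ?gt_eqF// (big_rem b) //=.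
have -> : t * (size s)%:R - e = (t - e) + (size (rem b s))%:R * t.
  have /(congr1 (fun n => n%:R : R)) := size_rem bs.
  have : (0 < size s)%N by rewrite -(ltr0n R).
  case: (size s) => // n _ /= ->; rewrite -natr1; ring.
apply: lerD; last first.
  rewrite -sum_const_seq; apply: ler_sum_seq => a /mem_rem /sK Ka.
  by apply/le_t/subgroupM => //; apply/subgroupM/subgroupV.
have Kb := sK _ bs.
(* With left factor [g y b^-1] and right factor 1, the net compares [g y b^-1 x] with
   [g y b^-1 b = g y]. *)
have : `|left_average w F (y *m invmx b *m x) - left_average w F y| <= e.
  have -> : left_average w F y = left_average w F (y *m invmx b *m b).
    by rewrite mulmxKV // subgroup_unit.
  apply: left_average_dist => // g gw.
  have := bP (g *m (y *m invmx b)) 1%:M; rewrite !mulmx1 !mulmxA; apply.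
    by apply/subgroupM/subgroupV => //; apply/subgroupM => //; apply: sw.2.
  exact: subgroup1.
rewrite ler_norml => /andP[_]; move: le_y; rewrite /left_average; lra.
Qed.

(** Take an average with an upper bound [t] less than [c] above the infimum of all such bounds. If
    it dipped below [t - e], [left_average_decrease] would produce a bound below the infimum. *)
Lemma left_average_osc1 F e : 0 < e -> almost_periodic F ->
  exists2 w, sample w & forall x y, K x -> K y ->
    `|left_average w F x - left_average w F y| <= e.
Proof.
move=> e0 apF; have e20 : 0 < e / 2 by rewrite divr_gt0.
have [c c0 decr] := left_average_decrease e20 apF.
pose S := [set t | exists2 w, sample w & forall x, K x -> left_average w F x <= t].
have [B BP] := almost_periodic_lbound apF.
have sample1 : sample [:: 1%:M] by split=> // g; rewrite inE => /eqP ->; apply: subgroup1.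
have S_lb : has_lbound S.
  exists B => t [w sw /(_ _ subgroup1)]; apply: le_trans.
  by apply: left_average_ge => //; apply: subgroup1.
have S_inf : has_inf S.
  split => //.
  have apNF : almost_periodic (fun x => - F x).
    move=> r /apF[s sK sP]; exists s => // a /sP[b bs bP]; exists b => // x y Kx Ky.
    by rewrite -opprD normrN; apply: bP.
  have [B' B'P] := almost_periodic_lbound apNF.
  exists (- B'), [:: 1%:M] => // x Kx; apply: left_average_le => // y Ky.
  by rewrite lerNr; apply: B'P.
have [t [w sw le_t] lt_t] := inf_adherent c0 S_inf.
exists w => //.
have lb y : K y -> t - e <= left_average w F y.
  move=> Ky; rewrite leNgt; apply/negP => lty.
  have [|w' sw' le_w'] := decr w t sw le_t.
    by exists y => //; rewrite mulrC divfK ?pnatr_eq0// ltW.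
  by have /(ge_inf S_lb) : S (t - c); [exists w' | lra].
move=> x y Kx Ky; rewrite ler_norml.
have := lb _ Kx; have := lb _ Ky; have := le_t _ Kx; have := le_t _ Ky; lra.
Qed.

(** By induction: the further average that flattens the next function keeps the bound on the
    oscillation of those already flattened. *)
Lemma left_average_osc (F : nat -> 'M[R]_d -> R) n e : 0 < e ->
  (forall i, almost_periodic (F i)) ->
  exists2 w, sample w & forall i x y, (i < n)%N -> K x -> K y ->
    `|left_average w (F i) x - left_average w (F i) y| <= e.
Proof.
move=> e0 apF; elim: n => [|n [w sw osc]].
  by exists [:: 1%:M] => //; split=> // g; rewrite inE => /eqP ->; apply: subgroup1.
have [w' sw' osc'] := left_average_osc1 e0 (almost_periodic_average sw (apF n)).
exists (sample_mul w w'); first exact: sample_mulP.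
move=> i x y; rewrite ltnS leq_eqVlt !left_average_mul => /predU1P[->|ltin] Kx Ky.
  exact: osc'.
apply: left_average_dist => // g gw; apply: osc => //.
  by apply: subgroupM => //; apply: sw'.2.
by apply: subgroupM => //; apply: sw'.2.
Qed.

(** Every sample point [g] has a net point [b] with [F (g b^-1)] at least half of [F 1]. Hence the
    averages at the points [b^-1] add up to at least half of [F 1], whatever the sample, and they
    cannot all be small. *)
Lemma left_average_pos F : almost_periodic F ->
  (forall x, K x -> 0 <= F x) -> 0 < F 1%:M ->
  exists2 c, 0 < c & forall w, sample w -> exists2 x, K x & c <= left_average w F x.
Proof.
move=> apF F0 F1; have F12 : 0 < F 1%:M / 2 by rewrite divr_gt0.
have [s sK sP] := apF _ F12.
have s_neq0 : s != [::] by have [b] := sP _ subgroup1; case: (s).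
have s0 : 0 < (size s)%:R :> R by apply: (@sample_size s).
exists (F 1%:M / 4 / (size s)%:R) => [|w sw]; first by rewrite !divr_gt0.
apply: contrapT => noex.
have lt_c x : K x -> left_average w F x <= F 1%:M / 4 / (size s)%:R.
  by move=> Kx; rewrite leNgt; apply/negP => /ltW ltx; apply: noex; exists x.
have : \sum_(b <- s) left_average w F (invmx b) <= F 1%:M / 4.
  have -> : F 1%:M / 4 = \sum_(b <- s) (F 1%:M / 4 / (size s)%:R).
    by rewrite sum_const_seq [RHS]mulrC divfK ?gt_eqF.
  by apply: ler_sum_seq => b /sK/subgroupV/lt_c.
rewrite leNgt => /negP; apply; apply: (@lt_le_trans _ _ (F 1%:M / 2)); first lra.
rewrite -mulr_suml exchange_big /= ler_pdivlMr ?sample_size // mulrC -sum_const_seq.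
apply: ler_sum_seq => g gw; have Kg := sw.2 _ gw; have [b bs bP] := sP _ Kg.
have Kb := sK _ bs; rewrite (big_rem b) //=.
have : 0 <= \sum_(a <- rem b s) F (g *m invmx a).
  rewrite big_seq; apply: sumr_ge0 => a /mem_rem/sK/subgroupV Ka.
  by apply/F0/subgroupM.
have := bP 1%:M (invmx b) subgroup1 (subgroupV Kb).
rewrite !mul1mx mulmxV ?subgroup_unit // ler_norml => /andP[]; lra.
Qed.

End AlmostPeriodic.

(** * Euclidean inner product and reflections *)

Section EuclideanSpace.
Variables (R : realType) (d : nat).
Implicit Types (x y u : 'rV[R]_d) (A : 'M[R]_d).

Lemma dotr_mulmx x y : dotr x y = (x *m y^T) ord0 ord0.
Proof. by rewrite mxE; apply: eq_bigr => i _; rewrite mxE. Qed.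

Lemma dotrC x y : dotr x y = dotr y x.
Proof. by apply: eq_bigr => i _; rewrite mulrC. Qed.

Lemma dotrBl x y u : dotr (x - y) u = dotr x u - dotr y u.
Proof. by rewrite !dotr_mulmx mulmxBl !mxE. Qed.

Lemma dotrBr x y u : dotr u (x - y) = dotr u x - dotr u y.
Proof. by rewrite dotrC dotrBl !(dotrC u). Qed.

Lemma dotrZl a x u : dotr (a *: x) u = a * dotr x u.
Proof. by rewrite !dotr_mulmx -scalemxAl mxE. Qed.

Lemma dotrZr a x u : dotr u (a *: x) = a * dotr u x.
Proof. by rewrite dotrC dotrZl dotrC. Qed.

Lemma dotr_ge0 x : 0 <= dotr x x.
Proof. by apply: sumr_ge0 => i _; rewrite -expr2 sqr_ge0. Qed.

Lemma dotr_eq0 x : dotr x x = 0 -> x = 0.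
Proof.
move=> x0; apply/rowP => i; rewrite mxE; apply/eqP.
rewrite -(sqrf_eq0 (x ord0 i)) eq_le sqr_ge0 andbT -{1}x0 /dotr (bigD1 i) //= -expr2.
by rewrite lerDl; apply: sumr_ge0 => j _; rewrite -expr2 sqr_ge0.
Qed.

Lemma enorm_sqr x : enorm x ^+ 2 = dotr x x.
Proof. by rewrite sqr_sqrtr // dotr_ge0. Qed.

Lemma enorm_neq0 x : x != 0 -> enorm x != 0.
Proof.
by apply: contra => /eqP x0; apply/eqP/dotr_eq0; rewrite -enorm_sqr x0 expr0n.
Qed.

Lemma unit_sphereP u : unit_sphere R d u -> dotr u u = 1.
Proof. by rewrite -enorm_sqr => ->; rewrite expr1n. Qed.

Lemma unit_sphere_normalize x : x != 0 -> unit_sphere R d ((enorm x)^-1 *: x).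
Proof.
move=> x0; rewrite /unit_sphere /= {1}/enorm dotrZl dotrZr -enorm_sqr.
by rewrite expr2 mulKf ?mulVf ?enorm_neq0 // sqrtr1.
Qed.

Lemma mul_reflection_mx x u : x *m reflection_mx u = reflection u x.
Proof. exact: mul_rV_lin1. Qed.

Lemma dotr_reflection u x y : unit_sphere R d u ->
  dotr (reflection u x) (reflection u y) = dotr x y.
Proof.
move=> /unit_sphereP u1.
rewrite /reflection dotrBl !dotrBr !dotrZl !dotrZr u1 (dotrC u y); ring.
Qed.

Lemma dotr_reflection_axis u x : unit_sphere R d u ->
  dotr (reflection u x) u = - dotr x u.
Proof. by move=> /unit_sphereP u1; rewrite dotrBl dotrZl u1; ring. Qed.

Lemma reflectionK u x : unit_sphere R d u -> reflection u (reflection u x) = x.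
Proof.
move=> u1; rewrite {1}/reflection dotr_reflection_axis //.
by rewrite /reflection mulrN scaleNr opprK subrK.
Qed.

Lemma orthogonal_reflection u : unit_sphere R d u ->
  orthogonal_group R d (reflection_mx u).
Proof.
move=> u1; apply/matrixP => i j.
have -> (B : 'M[R]_d) :
    (B *m B^T) i j = dotr (delta_mx ord0 i *m B) (delta_mx ord0 j *m B).
  by rewrite -!rowE mxE; apply: eq_bigr => k _; rewrite !mxE.
rewrite !mul_reflection_mx dotr_reflection // dotr_mulmx trmx_delta.
by rewrite mul_delta_mx_cond mulmxnE !mxE eqxx.
Qed.

(** For distinct [x] and [y], the reflection along [x - y] works, because equal norms give
    [|x - y|^2 = 2 x.(x - y)]. The identity covers [x = y], where there is no direction to
    normalize. *)
Lemma orthogonal_transitive x y : enorm x = enorm y ->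
  exists2 A, orthogonal_group R d A & x *m A = y.
Proof.
move=> exy; have [<-|xy] := eqVneq x y.
  by exists 1%:M; rewrite ?mulmx1 // /orthogonal_group /= trmx1 mulmx1.
have v0 : x - y != 0 by rewrite subr_eq0.
pose u := (enorm (x - y))^-1 *: (x - y).
have u1 : unit_sphere R d u by apply: unit_sphere_normalize.
exists (reflection_mx u); first exact: orthogonal_reflection.
rewrite mul_reflection_mx /reflection /u dotrZr scalerA.
have ev : enorm (x - y) ^+ 2 = 2 * dotr x (x - y).
  rewrite enorm_sqr !dotrBl !dotrBr (dotrC y x) -(enorm_sqr x) exy enorm_sqr; ring.
have -> : 2 * ((enorm (x - y))^-1 * dotr x (x - y)) * (enorm (x - y))^-1 = 1.
  rewrite [2 * _]mulrCA -ev; field; exact: enorm_neq0.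
by rewrite scale1r opprB addrC subrK.
Qed.

End EuclideanSpace.

(** * Max norm estimates, uniform continuity and total boundedness *)

Section MatrixNorm.
Variable R : realType.

Lemma mx_norm_coord m n (A : 'M[R]_(m, n)) i j : `|A i j| <= `|A|.
Proof.
rewrite [leRHS]mx_normrE.
exact: (le_bigmax _ (fun k => `|A k.1 k.2|) (i, j)).
Qed.

Lemma mx_norm_le m n (A : 'M[R]_(m, n)) c :
  0 <= c -> (forall i j, `|A i j| <= c) -> `|A| <= c.
Proof. by move=> c0 Ac; rewrite [leLHS]mx_normrE; apply: bigmax_le. Qed.

Lemma mx_norm_mul m n p (A : 'M[R]_(m, n)) (B : 'M[R]_(n, p)) :
  `|A *m B| <= n%:R * `|A| * `|B|.
Proof.
apply: mx_norm_le => [|i j]; first by rewrite !mulr_ge0.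
rewrite mxE; apply: le_trans (ler_norm_sum _ _ _) _.
have -> : n%:R * `|A| * `|B| = \sum_(k < n) (`|A| * `|B|).
  by rewrite sumr_const card_ord -mulrA mulr_natl.
by apply: ler_sum => k _; rewrite normrM ler_pM // mx_norm_coord.
Qed.

Lemma mx_norm_orthogonal d (A : 'M[R]_d) : orthogonal_group R d A -> `|A| <= 1.
Proof.
move=> OA; apply: mx_norm_le => // i j.
rewrite -(@expr_le1 _ 2) // real_normK ?num_real //.
have <- : (A *m A^T) i i = 1 by rewrite OA mxE eqxx.
rewrite mxE (bigD1 j) //= mxE -expr2 lerDl; apply: sumr_ge0 => k _.
by rewrite mxE -expr2 sqr_ge0.
Qed.

Lemma mx_norm_unit d (u : 'rV[R]_d) : unit_sphere R d u -> `|u| <= 1.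
Proof.
move=> /unit_sphereP u1; apply: mx_norm_le => // i j.
rewrite -(@expr_le1 _ 2) // real_normK ?num_real // -u1 /dotr (bigD1 j) //= ord1.
by rewrite -expr2 lerDl; apply: sumr_ge0 => k _; rewrite -expr2 sqr_ge0.
Qed.

Lemma dotr_norm_le d (x u : 'rV[R]_d) : unit_sphere R d u ->
  `|dotr x u| <= d%:R * `|x|.
Proof.
move=> /mx_norm_unit u1; apply: le_trans (ler_norm_sum _ _ _) _.
have -> : d%:R * `|x| = \sum_(k < d) `|x| by rewrite sumr_const card_ord mulr_natl.
apply: ler_sum => k _; rewrite normrM -[leRHS]mulr1 ler_pM // ?mx_norm_coord //.
by apply: le_trans u1; apply: mx_norm_coord.
Qed.

Lemma near_dist_lt (V : normedModType R) (x : V) e :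
  0 < e -> \forall y \near x, `|x - y| < e.
Proof. by move=> e0; apply/nbhs_normP; exists e. Qed.

Lemma lipschitz_map_continuous (V W : normedModType R) (f : V -> W) c :
  (forall x y, `|f x - f y| <= c * `|x - y|) -> continuous f.
Proof.
move=> fc x; apply/cvgrPdist_le => e e0.
have c0 : 0 < `|c| + 1 by rewrite ltr_wpDl.
near=> y; apply: le_trans (fc _ _) _.
have : `|x - y| <= e / (`|c| + 1).
  by apply: ltW; near: y; apply: near_dist_lt; rewrite divr_gt0.
rewrite ler_pdivlMr // => ?; apply: le_trans (_ : `|x - y| * (`|c| + 1) <= _) => //.
by rewrite mulrC ler_wpM2l //; have := ler_norm c; lra.
Unshelve. all: by end_near. Qed.

Lemma mulmxr_continuous m n p (B : 'M[R]_(n, p)) :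
  continuous (fun A : 'M[R]_(m, n) => A *m B).
Proof.
apply: (@lipschitz_map_continuous 'M[R]_(m, n) 'M[R]_(m, p) _ (n%:R * `|B|)) => A C.
by rewrite -mulmxBl mulrAC mx_norm_mul.
Qed.

Lemma mulmxl_continuous m n p (A : 'M[R]_(m, n)) :
  continuous (fun B : 'M[R]_(n, p) => A *m B).
Proof.
apply: (@lipschitz_map_continuous 'M[R]_(n, p) 'M[R]_(m, p) _ (n%:R * `|A|)) => B C.
by rewrite -mulmxBr mx_norm_mul.
Qed.

Lemma dotr_continuous d (u : 'rV[R]_d) : continuous (fun x => dotr x u).
Proof.
have -> : (fun x => dotr x u) =
    (fun M : 'M[R]_1 => M ord0 ord0) \o (fun x => x *m u^T).
  by apply/funext => x; rewrite dotr_mulmx.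
move=> x; apply: continuous_comp; first exact: mulmxr_continuous.
exact: coord_continuous.
Qed.

Lemma reflection_continuous d (u : 'rV[R]_d) : continuous (reflection u).
Proof.
have -> : (reflection u : 'rV[R]_d -> 'rV[R]_d) = (fun x => x *m reflection_mx u).
  by apply/funext => x; rewrite mul_reflection_mx.
exact: mulmxr_continuous.
Qed.

(** Cut the cube of matrices with entries in [-1, 1] into cells of side [e] and choose an element of
    [K] in each cell that meets [K]. *)
Lemma totally_bounded_mx d (K : set 'M[R]_d) e : 0 < e -> K !=set0 ->
  (forall a, K a -> `|a| <= 1) ->
  exists2 s : seq 'M[R]_d, {in s, forall b, K b} &
    forall a, K a -> exists2 b, b \in s & `|a - b| <= e.
Proof.
move=> e0 [x0 Kx0] K1; pose N := Num.truncn (2 / e).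
pose r (a : 'M[R]_d) i j : nat := Num.truncn ((a i j + 1) / e).
have a1 a i j : K a -> 0 <= (a i j + 1) / e <= 2 / e.
  move=> /K1; have := mx_norm_coord a i j => /le_trans/[apply].
  by rewrite ler_norml => /andP[? ?]; apply/andP; split;
    [apply: divr_ge0 => //; lra | rewrite ler_pM2r ?invr_gt0 //; lra].
pose cell a := [ffun p : 'I_d * 'I_d => inord (r a p.1 p.2) : 'I_N.+1].
(* Cells that miss [K] get the default [x0], which keeps the net inside [K]. *)
pose rep t := xget x0 [set a | K a /\ cell a = t].
exists [seq rep t | t <- enum {ffun 'I_d * 'I_d -> 'I_N.+1}].
  by move=> _ /mapP[t _ ->]; rewrite /rep; case: xgetP => [b _ []|].
move=> a Ka; exists (rep (cell a)); first by rewrite map_f // mem_enum.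
have [Kb ab] : K (rep (cell a)) /\ cell (rep (cell a)) = cell a.
  exact: (@xgetPex _ x0 [set b | K b /\ cell b = cell a]) (ex_intro _ a _).
move: (rep _) Kb ab => b Kb ab; apply: mx_norm_le => [|i j]; first exact: ltW.
have rN c : K c -> (r c i j < N.+1)%N.
  by move=> /(a1 _ i j)/andP[_]; rewrite ltnS; apply: le_truncn.
have rab : r a i j = r b i j.
  move/ffunP/(_ (i, j)): ab; rewrite !ffunE /= => /(congr1 val).
  by rewrite /= !inordK ?rN.
have /andP[a0 _] := a1 _ i j Ka; have /andP[b0 _] := a1 _ i j Kb.
have := truncn_itv a0; have := truncn_itv b0; rewrite -/(r a i j) -/(r b i j) -rab.
rewrite !ler_pdivlMr // !ltr_pdivrMr // -natr1 !mulrDl mul1r !mxE ler_norml.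
by move=> /andP[? ?] /andP[? ?]; apply/andP; split; lra.
Qed.

(** A form of Heine-Cantor in which only [p] is confined to the ball. The covering form of
    compactness, along radii tending to 0 from the right, makes the local radius uniform. *)
Lemma closed_ball_unif_continuous d (f : 'rV[R]_d -> R) r e :
  continuous f -> 0 < e ->
  exists2 c, 0 < c & forall p q, `|p| <= r -> `|p - q| <= c -> `|f p - f q| <= e.
Proof.
move=> cf e0; pose B := [set p : 'rV[R]_d | `|p| <= r].
have cB : compact B.
  apply: bounded_closed_compact.
    exists r; split; first exact: num_real.
    by move=> t rt p /= pr; apply/(le_trans pr)/ltW.
  by apply: (@closed_comp _ _ (fun p : 'rV[R]_d => `|p|) [set t | t <= r]);
    [move=> p _; apply: norm_continuous | apply: closed_le].
move/compact_near_coveringP: cB => /(_ R (0^'+)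
  (fun c p => forall q, `|p - q| <= c -> `|f p - f q| <= e)) cB.
have : \forall c \near 0^'+, B `<=`
    (fun p => forall q, `|p - q| <= c -> `|f p - f q| <= e).
  apply: cB => p _.
  have /cvgrPdist_le/(_ (e / 2)) : f q @[q --> p] --> f p by apply: cf.
  rewrite divr_gt0 // => /(_ isT)/nbhs_normP[c /= c0 cP].
  have nb r' : 0 < r' -> \forall p' \near p, `|p - p'| < r'.
    exact: (@near_dist_lt 'rV[R]_d p).
  near=> p' t => /= q p'q.
  have fp : `|f p - f p'| <= e / 2.
    apply: cP => /=; by near: p'; apply: nb.
  have fq : `|f p - f q| <= e / 2.
    apply: cP => /=; rewrite -(subrKA p') (le_lt_trans (ler_normD _ _)) //.
    rewrite (splitr c) ltr_leD //; last first.
      by apply: (le_trans p'q); near: t; apply: nbhs_right_le; rewrite divr_gt0.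
    by near: p'; apply: nb; rewrite divr_gt0.
  rewrite distrC -(subrKA (f p)) (le_trans (ler_normD _ _)) // (splitr e).
  by rewrite lerD // distrC.
move=> H; near (0 : R)^'+ => c; exists c; first by near: c; apply: nbhs_right_gt.
move=> p q pr; move: q; move: p pr; near: c; exact: H.
Unshelve. all: by end_near. Qed.

(** The orbit of [y] stays in a ball, near which [f] is uniformly continuous, and [K] is totally
    bounded. A fine net of [K] then works for all translations at once, as multiplication by
    elements of [K] expands distances by a bounded factor. *)
Lemma almost_periodic_orbit d (K : set 'M[R]_d) (f : 'rV[R]_d -> R) y :
  is_orthogonal_subgroup K -> continuous f ->
  almost_periodic K (fun g => f (y *m g)).
Proof.
move=> gK cf e e0; have KO a : K a -> `|a| <= 1.
  by case: gK => + _ _ _ => /[apply]/mx_norm_orthogonal.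
pose r := d%:R * `|y|.
have [c c0 cP] := closed_ball_unif_continuous r cf e0.
(* Since [|y x| <= r] and each product costs a factor [d], [|y x (a - b) z| <= d d r |a - b|];
   adding 1 keeps [D] positive. *)
pose D := d%:R * d%:R * r + 1.
have D0 : 0 < D.
  by rewrite ltr_wpDl // /r !mulr_ge0.
have [s sK sP] :=
  @totally_bounded_mx d K _ (divr_gt0 c0 D0) (ex_intro _ _ (subgroup1 gK)) KO.
exists s => // a Ka; have [b bs ab] := sP _ Ka; exists b => // x z Kx Kz.
have norm_orbit g : K g -> `|y *m g| <= r.
  move=> /KO g1; apply: le_trans (mx_norm_mul _ _) _.
  by rewrite ler_piMr // mulr_ge0.
apply: cP; first by apply: norm_orbit; do 2!apply: (subgroupM gK) => //; apply: Ka.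
rewrite -mulmxBr -mulmxBl -mulmxBr !mulmxA.
apply: le_trans (mx_norm_mul _ _) _.
have ab1 : `|y *m x *m (a - b)| <= d%:R * r * (c / D).
  apply: le_trans (mx_norm_mul _ _) _.
  by rewrite ler_pM ?mulr_ge0 // ler_wpM2l // norm_orbit.
apply: (@le_trans _ _ (d%:R * (d%:R * r * (c / D)))).
  by rewrite -[leRHS]mulr1 ler_pM ?mulr_ge0 ?KO // ler_wpM2l.
rewrite !mulrA ler_pdivrMr // [leRHS]mulrC; apply: ler_wpM2r; first exact: ltW.
by rewrite /D /r !mulrA lerDl.
Qed.

End MatrixNorm.

(** * Polarized functions and their invariance groups *)

Section Polarization.
Variables (R : realType) (d : nat).
Implicit Types (phi : 'rV[R]_d -> R) (G : set 'rV[R]_d) (K : set 'M[R]_d).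

(** The cover at the direction of [- c] yields [c.u < 0]. Compactness of the max norm unit sphere
    makes the bound uniform, and homogeneity extends it to all nonzero [c]. *)
Lemma half_space_cover_uniform G :
  unit_sphere R d `<=` \bigcup_(u in G) half_space u ->
  exists2 r : R, 0 < r & forall c : 'rV[R]_d, c != 0 ->
    exists2 u, G u & dotr c u <= - (r * `|c|).
Proof.
move=> C1; pose B := [set p : 'rV[R]_d | `|p| = 1].
have cB : compact B.
  apply: bounded_closed_compact.
    by exists 1; split; [exact: num_real | move=> t rt p /= ->; exact: ltW].
  by apply: (@closed_comp _ _ (fun p : 'rV[R]_d => `|p|) [set t | t = 1]);
    [move=> p _; apply: norm_continuous | apply: closed_eq].
move/compact_near_coveringP: cB => /(_ R (0^'+)
  (fun r c => exists2 u, G u & dotr c u <= - r)) cB.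
have H : \forall r \near 0^'+, B `<=` (fun c => exists2 u, G u & dotr c u <= - r).
  apply: cB => c /= c1.
  have Nc0 : - c != 0 by rewrite oppr_eq0 -normr_eq0 c1 oner_neq0.
  have [u Gu cu] := C1 _ (unit_sphere_normalize Nc0).
  have {cu} cu : dotr c u < 0.
    move: cu; rewrite /half_space /= dotrZl pmulr_rgt0.
      by rewrite -sub0r dotrBl -{1}(subrr c) dotrBl subrr sub0r oppr_gt0.
    by rewrite invr_gt0 lt_neqAle sqrtr_ge0 andbT eq_sym enorm_neq0.
  have nc : \forall c' \near c, dotr c' u < dotr c u / 2.
    by apply: (cvgr_lt _ (@dotr_continuous R d u c)); lra.
  near=> c' r => /=; exists u => //.
  have c'u : dotr c' u < dotr c u / 2 by near: c'.
  have : r <= - dotr c u / 2.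
    by near: r; apply: nbhs_right_le; rewrite divr_gt0 // oppr_gt0.
  lra.
near (0 : R)^'+ => r; exists r; first by near: r; apply: nbhs_right_gt.
move=> c c0; have nc0 : 0 < `|c| by rewrite normr_gt0.
have : B (`|c|^-1 *: c).
  rewrite /B /= mx_normZ normrV ?unitfE ?gt_eqF //.
  by rewrite normr_id mulVf // gt_eqF.
have HB : B `<=` (fun c => exists2 u, G u & dotr c u <= - r) by near: r; exact: H.
move=> /HB[u Gu]; rewrite dotrZl ler_pdivrMl // mulrN mulrC => cu.
by exists u.
Unshelve. all: by end_near. Qed.

(** For unit [u] the gap equals [phi(x) (x.u) + phi(R_u x) (R_u x.u)], which ties its mean to that
    of [phi(p) p]. *)
Definition polarization_gap phi u x : R := (phi x - phi (reflection u x)) * dotr x u.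

(** Both factors change sign under the reflection, so it suffices to look at [half_space u], where
    the maximum is at least [phi (R_u x)]. *)
Lemma polarized_gap_ge0 phi u : unit_sphere R d u -> two_point_symm u phi = phi ->
  forall x, 0 <= polarization_gap phi u x.
Proof.
move=> u1 Sphi x; rewrite /polarization_gap.
have le_x y : 0 < dotr y u -> phi (reflection u y) <= phi y.
  move=> yu; rewrite -{2}Sphi /two_point_symm mem_set //.
  by rewrite le_max lexx.
have [xu|xu|->] := ltgtP (dotr x u) 0; last by rewrite mulr0.
  apply: mulr_le0; last exact: ltW.
  rewrite subr_le0 -{1}(reflectionK x u1); apply: le_x.
  by rewrite dotr_reflection_axis // oppr_gt0.
by rewrite mulr_ge0 ?subr_ge0 ?le_x // ltW.
Qed.

(* Take a finite sample of points p in the K-orbit of y with nearly K-invariant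
   averages, and let c be the average of phi(p) p. Substituting R_u p for p gives
   2 c.u ~ average of the gap of u >= 0 for all u in G, so (C1) forces c ~ 0, and
   then the gap of u0 averages to almost 0. *)
Lemma polarized_reflection_invariant phi G K u0 y :
  continuous phi -> G `<=` unit_sphere R d ->
  unit_sphere R d `<=` \bigcup_(u in G) half_space u ->
  is_orthogonal_subgroup K -> (forall u, G u -> K (reflection_mx u)) ->
  (forall u x, G u -> 0 <= polarization_gap phi u x) ->
  G u0 -> polarization_gap phi u0 y = 0.
Proof.
move=> phi_cont G1 C1 gK GK gap0 Gu0; apply/eqP/negP => /negP gapy.
have gap_cont : continuous (polarization_gap phi u0).
  move=> x; apply: (@cvgM _ _ (nbhs x)); last exact: dotr_continuous.
  apply: (@cvgB _ _ _ (nbhs x)); first exact: phi_cont.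
  by apply: continuous_comp; [exact: reflection_continuous | exact: phi_cont].
have [r r0 rP] := half_space_cover_uniform C1.
pose F0 (g : 'M[R]_d) := polarization_gap phi u0 (y *m g).
pose Fi (i : 'I_d) (g : 'M[R]_d) := phi (y *m g) * (y *m g) ord0 i.
(* Indices below [d] give the coordinates of [phi(p) p]; index [d] is out of range for [insub] and
   gives the gap. Hence [d.+1] functions are flattened together. *)
pose F n := if insub n is Some i then Fi i else F0.
have apF0 : almost_periodic K F0 by apply: almost_periodic_orbit.
have apFi i : almost_periodic K (Fi i).
  apply: (@almost_periodic_orbit _ _ _ (fun p => phi p * p ord0 i)) => // p.
  by apply: (@cvgM _ _ (nbhs p)); [exact: phi_cont | exact: coord_continuous].
have apF n : almost_periodic K (F n) by rewrite /F; case: insub.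
have [D D0 DP] : exists2 D, 0 < D &
    forall w, sample K w -> exists2 x, K x & D <= left_average w F0 x.
  apply: left_average_pos => // [x _|]; first exact: gap0.
  by rewrite /F0 mulmx1 lt_neqAle eq_sym gapy gap0.
pose N := d%:R : R.
(* In multiples of [e], the terms pay for the oscillation of the mean gap, for that of [c.u0], and
   for [2 c.u0] itself; [e] is then chosen to make the total [D / 2]. *)
pose E := 1 + N + N * N / r.
have N0 : 0 <= N by rewrite ler0n.
have NNr0 : 0 <= N * N / r by apply: divr_ge0; [exact: mulr_ge0 | exact: ltW].
have E0 : 0 < E by rewrite /E; lra.
pose e := D / 2 / E.
have e0 : 0 < e by rewrite !divr_gt0.
have [w sw osc] := left_average_osc gK d.+1 e0 apF.
have [x Kx Dx] := DP _ sw.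
(* The mean of [phi(p) p] over the points [p = y h g], with [h] in the sample. *)
pose c (g : 'M[R]_d) := \row_i left_average w (Fi i) g.
have osc_c g u : K g -> unit_sphere R d u ->
    `|dotr (c 1%:M) u - dotr (c g) u| <= N * e.
  move=> Kg u1; rewrite -dotrBl; apply: le_trans (dotr_norm_le _ u1) _.
  rewrite ler_wpM2l //; apply: mx_norm_le => [|i j]; first exact: ltW.
  rewrite !mxE; have := osc j 1%:M g (ltn_trans (ltn_ord j) (ltnSn d)) (subgroup1 gK) Kg.
  by rewrite /F insubT // => ?; rewrite (_ : Sub _ _ = j) //; apply: val_inj.
have cE g u : dotr (c g) u =
    (\sum_(h <- w) phi (y *m (h *m g)) * dotr (y *m (h *m g)) u) / (size w)%:R.
  rewrite /dotr /c; under eq_bigr do rewrite mxE /left_average mulrAC.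
  rewrite -mulr_suml; congr (_ / _); under eq_bigr do rewrite mulr_suml.
  rewrite exchange_big /=; apply: eq_bigr => h _; rewrite mulr_sumr.
  by apply: eq_bigr => i _; rewrite mulrA.
have gapE u : unit_sphere R d u ->
    dotr (c 1%:M) u + dotr (c (reflection_mx u)) u =
    (\sum_(h <- w) polarization_gap phi u (y *m h)) / (size w)%:R.
  move=> u1; rewrite !cE -mulrDl -big_split /=; congr (_ / _).
  apply: eq_bigr => h _; rewrite mulmx1 mulmxA mul_reflection_mx.
  by rewrite dotr_reflection_axis // /polarization_gap; ring.
have c_ge u : G u -> - (N * e) <= 2 * dotr (c 1%:M) u.
  move=> Gu; have := osc_c _ _ (GK _ Gu) (G1 _ Gu).
  have : 0 <= dotr (c 1%:M) u + dotr (c (reflection_mx u)) u.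
    by rewrite gapE ?divr_ge0 ?sumr_ge0 //; [move=> h _; exact: gap0 | exact: G1].
  by rewrite ler_norml => ? /andP[? ?]; lra.
(* The cover provides [u] with [c.u <= - r |c|], whereas [2 c.u >= - N e]. *)
have c_le : 2 * `|c 1%:M| <= N * e / r.
  have [->|cn0] := eqVneq (c 1%:M) 0.
    by rewrite normr0 mulr0; apply: divr_ge0; [apply: mulr_ge0 => //|]; exact: ltW.
  have [u Gu cu] := rP _ cn0; rewrite ler_pdivlMr //.
  have := c_ge _ Gu; nra.
have := dotr_norm_le (c 1%:M) (G1 _ Gu0).
have := osc_c _ _ (GK _ Gu0) (G1 _ Gu0).
have : left_average w F0 1%:M = dotr (c 1%:M) u0 + dotr (c (reflection_mx u0)) u0.
  rewrite gapE; last exact: G1.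
  by rewrite /left_average; under eq_bigr do rewrite mulmx1.
have := osc d x 1%:M (ltnSn d) Kx (subgroup1 gK).
rewrite /F insubF ?ltnn // => oscx F01 osc0 cu0.
(* The final chain: [D] is at most the mean gap at [x], hence at most [e] plus the mean gap at 1,
   hence at most [e + N e + 2 c.u0 <= e E = D / 2]. *)
have NNr : N * (2 * `|c 1%:M|) <= N * (N * e / r) by rewrite ler_wpM2l.
have eE : e * E = D / 2 by rewrite divfK ?gt_eqF.
have eE' : e * E = e + N * e + N * (N * e / r) by rewrite /E; field; rewrite gt_eqF.
move: oscx osc0 cu0; rewrite !ler_norml => /andP[? ?] /andP[? ?] /andP[? ?].
lra.
Qed.

(** Once this stabilizer of [phi] contains the reflections, it contains the group they generate.
    Closure under inverses uses that [invmx] is the transpose here. *)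
Lemma invariant_subgroup phi :
  is_orthogonal_subgroup
    [set A | orthogonal_group R d A /\ forall x, phi (x *m A) = phi x].
Proof.
split=> [A []//||A B [OA phiA] [OB phiB]|A [OA phiA]].
- by split=> [|x]; rewrite /orthogonal_group /= ?trmx1 mulmx1.
- split=> [|x]; last by rewrite mulmxA phiB phiA.
  by rewrite /orthogonal_group /= trmx_mul mulmxA -(mulmxA A) OB mulmx1.
- have [uA _] := mulmx1_unit OA.
  have AV : invmx A = A^T by rewrite -[LHS]mulmx1 -OA mulKmx.
  split=> [|x]; last by rewrite -[in RHS](mulmxKV uA x) phiA.
  by rewrite /orthogonal_group /= AV trmxK -AV mulVmx.
Qed.

Lemma generated_is_subgroup G : G `<=` unit_sphere R d ->
  is_orthogonal_subgroup (generated_subgroup [set reflection_mx u | u in G]).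
Proof.
move=> G1.
(* O(d) is the stabilizer of a constant function. *)
have O_gr : is_orthogonal_subgroup (orthogonal_group R d).
  have := invariant_subgroup (fun=> 0); congr is_orthogonal_subgroup.
  by apply/seteqP; split=> A // [].
split.
- move=> A; apply; split=> // _ [u Gu <-]; exact/orthogonal_reflection/G1.
- by move=> L [gL _]; apply: subgroup1 gL.
- move=> A B hA hB L LP; have [gL _] := LP.
  by apply: (subgroupM gL); [exact: hA | exact: hB].
- by move=> A hA L LP; have [gL _] := LP; apply: (subgroupV gL); exact: hA.
Qed.

End Polarization.

Theorem corollary1 (R : realType) (d : nat) (phi : 'rV[R]_d -> R)
    (G : set 'rV[R]_d)
    (phi_cont : continuous phi)
    (G_sphere : G `<=` unit_sphere R d)
    (C1 : unit_sphere R d `<=` \bigcup_(u in G) half_space u)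
    (C2 : dense_in_orthogonal_group
            (generated_subgroup [set reflection_mx u | u in G])) :
  (forall u, G u -> two_point_symm u phi = phi) <-> radial phi.
Proof.
split=> [Sphi x y exy | rad u Gu]; last first.
  apply/funext => x; rewrite /two_point_symm (rad _ x) ?maxxx ?minxx ?if_same //.
  by rewrite /enorm dotr_reflection //; apply: G_sphere.
have gap0 u z : G u -> polarization_gap phi u z = 0.
  move=> Gu; apply: (polarized_reflection_invariant _ phi_cont G_sphere C1
    (generated_is_subgroup G_sphere)) => // [v Gv L [_]|v t Gv].
  - by apply; exists v.
  - by apply: polarized_gap_ge0; [exact: G_sphere | exact: Sphi].
have refl_inv u z : G u -> phi (reflection u z) = phi z.
  move=> Gu; have /eqP := gap0 u z Gu.
  (* Either the two values agree, or [z] lies on the mirror and is fixed by the reflection. *)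
  rewrite /polarization_gap mulf_eq0 subr_eq0 => /orP[/eqP //|/eqP zu].
  by rewrite /reflection zu mulr0 scale0r subr0.
have [A OA <-] := orthogonal_transitive exy.
(* With [x] fixed, [L] is the preimage of a point under a continuous map, hence closed. It contains
   the generated group, so by density it contains O(d). *)
pose L := [set B : 'M[R]_d | phi (x *m B) = phi x].
have L_closed : closed L.
  apply: (@closed_comp _ _ (fun B : 'M[R]_d => phi (x *m B)) [set t | t = phi x]).
    move=> B _; apply: continuous_comp; [exact: mulmxl_continuous | exact: phi_cont].
  exact: closed_eq.
apply/esym; suff : L A by [].
rewrite (iffLR (closure_id L) L_closed).
apply: closureS (C2.2 _ OA) => B genB.
have [|_ phiB] := genB _ (conj (invariant_subgroup phi) _); last exact: phiB.
move=> _ [u Gu <-]; split=> [|z]; first exact/orthogonal_reflection/G_sphere.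
by rewrite mul_reflection_mx refl_inv.
Qed.
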